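(* Let $q$ be a prime power, let $k\ge 1$, and let $f(x_1,\dots,x_k)\in\mathbb{F}_q[x_1,\dots,x_k]$. For $\alpha\in\mathbb{F}_q^*$ and an integer $n\ge 0$, let $N_\alpha(n)$ be the number of coefficients of the polynomial $f^n$ that are equal to $\alpha$. Then there exist square matrices $\Phi_0,\Phi_1,\dots,\Phi_{q-1}$ with integer entries, all of the same size, and a column vector $v$ of integers, none of which depends on $\alpha$, such that for every $\alpha\in\mathbb{F}_q^*$ there is a row vector $u$ of integers with the following property. For any integer $n\geq 1$ with base $q$ expansion $n=a_0+a_1q+\cdots+a_rq^r$, $0\le a_i\le q-1$, we have $$N_\alpha(n)=u\,\Phi_{a_r}\Phi_{a_{r-1}}\cdots\Phi_{a_0}\,v.$$
   Context: $\mathbb{F}_q$ is the finite field with $q$ elements and $\mathbb{F}_q^*$ its set of nonzero elements. The number of coefficients of $f^n$ equal to $\alpha$ means the number of exponent vectors $\gamma\in\mathbb{N}^k$ ($\mathbb{N}=\{0,1,2,\dots\}$) such that the coefficient of $x_1^{\gamma_1}\cdots x_k^{\gamma_k}$ in $f^n$ is $\alpha$. *)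

(* Defs.v *)
From HB Require Import structures.
From mathcomp Require Import all_boot all_order all_algebra.
From mathcomp Require Export mpoly.

Set Implicit Arguments.
Unset Strict Implicit.
Unset Printing Implicit Defensive.

Import GRing.Theory.
Local Open Scope ring_scope.

(* The exponent vectors at which [p] has coefficient [alpha] are searched for
   in the finite support of [p]; this misses none of them when [alpha != 0]
   (see [mem_coef_exponents]) and is only meaningful in that case. *)
Definition coef_exponents (k : nat) (F : finFieldType) (p : {mpoly F[k]})
    (alpha : F) : seq 'X_{1..k} :=
  [seq m <- msupp p | p@_m == alpha].

Lemma coef_exponents_uniq (k : nat) (F : finFieldType) (p : {mpoly F[k]})
    (alpha : F) : uniq (coef_exponents p alpha).
Proof. exact: filter_uniq (msupp_uniq p). Qed.

Lemma mem_coef_exponents (k : nat) (F : finFieldType) (p : {mpoly F[k]})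
    (alpha : F) (m : 'X_{1..k}) :
  alpha != 0 -> (m \in coef_exponents p alpha) = (p@_m == alpha).
Proof.
move=> a0; rewrite mem_filter mcoeff_msupp andb_idr // => /eqP ->.
exact: a0.
Qed.

Definition coef_count (k : nat) (F : finFieldType) (f : {mpoly F[k]})
    (alpha : F) (n : nat) : nat :=
  size (coef_exponents (f ^+ n) alpha).

(* Main.v *)
(* Over a field with q elements, f^(b + n q) = f^b * (f^n)(x_1^q, ..., x_k^q).
   Splitting the exponents of g f^(b + n q) into residue classes modulo q
   therefore writes the count for g f^(b + n q) as the sum, over the residue
   vectors c, of the counts for h_c f^n, where h_c is the c-section of g f^b.
   If deg g and deg f are at most e, then deg h_c <= (e + (q-1) e) / q = e, so
   the finitely many polynomials g of degree at most e are stable under all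
   these sections: indexed by them, Phi_b counts how often each h occurs among
   the h_c, u lists the counts for the g themselves (n = 0), and v selects
   g = 1. *)
Require Import Defs.
From mathcomp Require Import all_boot all_order all_algebra all_field.
From mathcomp Require Import mpoly.

Set Implicit Arguments.
Unset Strict Implicit.
Unset Printing Implicit Defensive.

Import GRing.Theory.
Local Open Scope ring_scope.

Definition digit_mnm (q k : nat) (c : {ffun 'I_k -> 'I_q}) (m : 'X_{1..k}) :
  'X_{1..k} := [multinom (c i + m i * q)%N | i < k].

Lemma digit_mnm_inj (q k : nat) (c c' : {ffun 'I_k -> 'I_q})
    (m m' : 'X_{1..k}) :
  digit_mnm c m = digit_mnm c' m' -> c = c' /\ m = m'.
Proof.
move=> /mnmP eq_cm; have eq_i i: (c i + m i * q = c' i + m' i * q)%N.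
  by have:= eq_cm i; rewrite !mnmE.
have q_gt0 (i : 'I_k) : (0 < q)%N by apply: leq_ltn_trans (ltn_ord (c i)).
split.
  apply/ffunP => i; apply/val_inj; have:= congr1 (modn^~ q) (eq_i i).
  by rewrite /= !(addnC (nat_of_ord _)) !modnMDl !modn_small.
apply/mnmP => i; have:= congr1 (divn^~ q) (eq_i i).
by rewrite /= !(addnC (nat_of_ord _)) !divnMDl ?(q_gt0 i) // !divn_small ?addn0.
Qed.

Lemma digit_mnm_onto (q k : nat) (m : 'X_{1..k}) : (0 < q)%N ->
  exists (c : {ffun 'I_k -> 'I_q}) (m' : 'X_{1..k}), m = digit_mnm c m'.
Proof.
move=> q_gt0; exists [ffun i => Ordinal (ltn_pmod (m i) q_gt0)].
exists [multinom (m i %/ q)%N | i < k].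
by apply/mnmP => i; rewrite !mnmE ffunE /= addnC -divn_eq.
Qed.

Lemma leq_mdeg_digit_mnm (q k : nat) (c : {ffun 'I_k -> 'I_q})
    (m : 'X_{1..k}) : (mdeg m * q <= mdeg (digit_mnm c m))%N.
Proof.
rewrite !mdegE big_distrl /=; apply: leq_sum => i _.
by rewrite mnmE leq_addl.
Qed.

Lemma mcoeffMXE (k : nat) (R : nzRingType) (p : {mpoly R[k]})
    (m i : 'X_{1..k}) :
  (p * 'X_[m])@_i = if (m <= i)%MM then p@_(i - m) else 0.
Proof.
case: ifPn => [le_mi|nle_mi].
  by rewrite -[in LHS](submK le_mi) addmC mcoeffMX.
apply: memN_msupp_eq0; rewrite (perm_mem (msuppMX p m)).
by apply: contra nle_mi => /mapP[j _ ->]; apply: lem_addr.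
Qed.

(** Frobenius: [#|F|] is a power of the characteristic, so this power is additive on polynomials,
    and it fixes every coefficient because [a ^+ #|F| = a] in [F]. *)
Lemma mpoly_pow_card (F : finFieldType) (k : nat) (p : {mpoly F[k]}) :
  p ^+ #|F| = \sum_(m <- msupp p) p@_m *: 'X_[(m *+ #|F|)%MM].
Proof.
have [l l_pr pcharFl] := finPcharP F.
have q_nat: [pchar {mpoly F[k]}].-nat #|F|.
  rewrite (eq_pnat _ (pchar_lalg _)) (eq_pnat _ (pcharf_eq pcharFl)).
  by rewrite (card_pprimeChar pcharFl) pnatX pnat_id.
rewrite {1}[p]mpolyE.
rewrite (big_morph (fun h => h ^+ #|F|) (id1 := 0) (op1 := +%R)); last first.
- by rewrite expr0n (cardD1 0).
- by move=> h1 h2; apply: exprDn_pchar.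
by apply: eq_bigr => m _; rewrite exprZn expf_card mpolyXn.
Qed.

(** For [q > 0] the bound on [m] cuts nothing off: [digit_mnm c m] has degree at least that of [m],
    so beyond the bound it lies outside the support of [p]. *)
Definition msection (q k : nat) (R : nzRingType) (c : {ffun 'I_k -> 'I_q})
    (p : {mpoly R[k]}) : {mpoly R[k]} :=
  \sum_(m : 'X_{1..k < msize p}) p@_(digit_mnm c m) *: 'X_[m].

Lemma mcoeff_msection (q k : nat) (R : nzRingType) (c : {ffun 'I_k -> 'I_q})
    (p : {mpoly R[k]}) (m : 'X_{1..k}) : (0 < q)%N ->
  (msection c p)@_m = p@_(digit_mnm c m).
Proof.
move=> q_gt0; case: (ltnP (mdeg m) (msize p)) => [lt_mp|le_pm].
  exact: (mcoeff_mpoly (fun m => p@_(digit_mnm c m))).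
have le_mcm: (mdeg m <= mdeg (digit_mnm c m))%N.
  by apply: leq_trans (leq_mdeg_digit_mnm c m); apply: leq_pmulr.
rewrite [RHS]memN_msupp_eq0; last first.
  by apply: msize_mdeg_ge; apply: leq_trans le_mcm.
rewrite raddf_sum big1 //= => m' _; rewrite mcoeffZ mcoeffX.
case: eqP => [eq_m|_]; last by rewrite mulr0.
by have:= bmdeg m'; rewrite eq_m ltnNge le_pm.
Qed.

(** A shift of exponents by a multiple of [q] preserves residues and acts on the quotients alone. *)
Lemma msectionMXn (q k : nat) (R : nzRingType) (c : {ffun 'I_k -> 'I_q})
    (p : {mpoly R[k]}) (m : 'X_{1..k}) : (0 < q)%N ->
  msection c (p * 'X_[(m *+ q)%MM]) = msection c p * 'X_[m].
Proof.
move=> q_gt0; apply/mpolyP => i.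
rewrite mcoeff_msection // !mcoeffMXE mcoeff_msection //.
have ->: (m *+ q <= digit_mnm c i)%MM = (m <= i)%MM.
  apply: eq_forallb => j; rewrite mulmnE mnmE.
  by rewrite -leq_divRL // addnC divnMDl // divn_small ?addn0.
case: ifP => // /mnm_lepP le_mi; congr (_@__); apply/mnmP => j.
by rewrite !(mnmE, mulmnE) mulnBl addnBA // leq_mul2r le_mi orbT.
Qed.

Lemma msection_mul_pow_card (F : finFieldType) (k : nat)
    (c : {ffun 'I_k -> 'I_#|F|}) (p h : {mpoly F[k]}) :
  msection c (p * h ^+ #|F|) = msection c p * h.
Proof.
have q_gt0: (0 < #|F|)%N by rewrite (cardD1 0).
rewrite mpoly_pow_card [in RHS](mpolyE h) !mulr_sumr; apply/mpolyP => i.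
rewrite mcoeff_msection // !raddf_sum /=; apply: eq_bigr => m _.
by rewrite -!scalerAr !mcoeffZ -msectionMXn // mcoeff_msection.
Qed.

(** Division with remainder by [q] in each coordinate sends every exponent vector to exactly one
    pair (residue vector, quotient vector), so the sections share out the coefficients of [p]
    without overlap. *)
Lemma size_coef_exponents_msection (F : finFieldType) (q k : nat)
    (p : {mpoly F[k]}) (alpha : F) : (0 < q)%N -> alpha != 0 ->
  size (coef_exponents p alpha) =
    (\sum_(c : {ffun 'I_k -> 'I_q})
       size (coef_exponents (msection c p) alpha))%N.
Proof.
move=> q_gt0 a0.
pose s := [seq digit_mnm c m | c <- enum {: {ffun 'I_k -> 'I_q}},
  m <- coef_exponents (msection c p) alpha].
have uniq_s: uniq s.
  apply: allpairs_uniq_dep => [||[c m] [c' m'] _ _ /digit_mnm_inj[/= -> ->]] //.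
    exact: enum_uniq.
  by move=> c _; apply: coef_exponents_uniq.
rewrite (perm_size (uniq_perm (coef_exponents_uniq p alpha) uniq_s _)).
  by rewrite size_allpairs_dep sumnE big_map big_enum.
move=> m; rewrite mem_coef_exponents //; apply/idP/allpairsPdep.
  have [c [m' ->]] := digit_mnm_onto m q_gt0 => pm.
  by exists c, m'; rewrite mem_enum mem_coef_exponents // mcoeff_msection.
by case=> c [m' [_ pm ->]]; rewrite mem_coef_exponents ?mcoeff_msection in pm.
Qed.

Lemma msize_msection (q k e : nat) (R : nzRingType)
    (c : {ffun 'I_k -> 'I_q}) (p : {mpoly R[k]}) : (0 < q)%N ->
  (msize p <= (e * q).+1)%N -> (msize (msection c p) <= e.+1)%N.
Proof.
move=> q_gt0 le_p; rewrite msizeE; apply/bigmax_leqP_seq => m.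
rewrite mcoeff_msupp mcoeff_msection // -mcoeff_msupp => pm _.
have := leq_trans (msize_mdeg_lt pm) le_p; rewrite !ltnS.
by move/(leq_trans (leq_mdeg_digit_mnm c m)); rewrite leq_pmul2r.
Qed.

Lemma msizeM_leS (R : idomainType) (k d e : nat) (p h : {mpoly R[k]}) :
  (msize p <= d.+1 -> msize h <= e.+1 -> msize (p * h) <= (d + e).+1)%N.
Proof.
have [->|p0] := eqVneq p 0; first by rewrite mul0r msize0.
have [->|h0] := eqVneq h 0; first by rewrite mulr0 msize0.
rewrite msizeM // (mpolySpred _ p0) (mpolySpred _ h0) addSn addnS /= !ltnS.
exact: leq_add.
Qed.

Lemma msize_exp_leS (R : idomainType) (k e n : nat) (p : {mpoly R[k]}) :
  (msize p <= e.+1 -> msize (p ^+ n) <= (n * e).+1)%N.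
Proof.
move=> le_p; elim: n => [|n IHn]; first by rewrite expr0 msize1.
by rewrite exprS mulSn; apply: msizeM_leS.
Qed.

Lemma mpoly_bounded_enum (F : finFieldType) (k e : nat) :
  exists2 s : seq {mpoly F[k]}, uniq s & forall p, (p \in s) = (msize p <= e)%N.
Proof.
(* Finiteness: a polynomial of degree below [e] is given by its coefficients, a function between
   finite types. *)
pose P (c : {ffun 'X_{1..k < e} -> F}) : {mpoly F[k]} :=
  \sum_m c m *: 'X_[m].
exists [seq p <- undup (codom P) | (msize p <= e)%N] => [|p].
  by rewrite filter_uniq ?undup_uniq.
rewrite mem_filter mem_undup andb_idr // => le_p.
apply/codomP; exists [ffun m : 'X_{1..k < e} => p@_m].
by rewrite {1}[p](mpolywE le_p); apply: eq_bigr => m _; rewrite ffunE.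
Qed.

(** Grouping the indices [j] by the value [h j] turns a sum over sections into an entry of a
    vector-matrix product. *)
Lemma sum_count_seq (T : eqType) (J : finType) (s : seq T) (h : J -> T)
    (N : T -> nat) : uniq s -> (forall j, h j \in s) ->
  (\sum_j N (h j) = \sum_(x <- s) N x * #|[pred j | h j == x]|)%N.
Proof.
move=> s_uniq h_s.
rewrite (eq_bigr (fun j => \sum_(x <- s) (h j == x) * N x)%N); last first.
  move=> j _; rewrite (bigD1_seq (h j)) //= eqxx mul1n big1 ?addn0 // => x.
  by rewrite eq_sym => /negbTE->.
rewrite exchange_big /=; apply: eq_bigr => x _.
rewrite -big_distrl /= mulnC -sum1_card [in RHS]big_mkcond /=.
by congr (_ * _)%N; apply: eq_bigr => j _; rewrite inE; case: eqP.
Qed.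

Theorem theorem2p1 (q : nat) (F : finFieldType) (hq : #|F| = q)
    (k : nat) (hk : (1 <= k)%N) (f : {mpoly F[k]}) :
  exists (d : nat) (Phi : 'I_q -> 'M[int]_d.+1) (v : 'cV[int]_d.+1),
    forall alpha : F, alpha != 0 ->
    exists u : 'rV[int]_d.+1,
      forall (n r : nat) (a : 'I_r.+1 -> 'I_q),
        (1 <= n)%N ->
        n = (\sum_(i < r.+1) a i * q ^ i)%N ->
        (coef_count f alpha n)%:Z =
          (u *m (\prod_(i < r.+1) Phi (a (rev_ord i))) *m v) 0 0.
Proof.
subst q; set q := #|F|; have q_gt0: (0 < q)%N by rewrite /q (cardD1 0).
pose e := msize f; have le_f: (msize f <= e.+1)%N by apply: leqnSn.
have [s s_uniq mem_s] := mpoly_bounded_enum F k e.+1.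
have s1: 1 \in s by rewrite mem_s msize1.
(* The matrix size must be a successor; [s] is nonempty since it contains [1]. *)
have s_size: (size s).-1.+1 = size s by case: (s) s1.
pose h (b : 'I_q) (g : {mpoly F[k]}) (c : {ffun 'I_k -> 'I_q}) :=
  msection c (g * f ^+ b).
have h_s b g c: g \in s -> h b g c \in s.
  rewrite !mem_s => le_g; apply: msize_msection => //.
  apply: leq_trans (msizeM_leS le_g (msize_exp_leS b le_f)) _.
  (* The degree is at most [e + b * e], hence at most [q * e] because [b < q]. *)
  by rewrite ltnS -mulSn mulnC leq_mul2l ltn_ord orbT.
(* Counts form a row vector multiplied on its right, so the column is indexed by the polynomial
   being split and the row by the resulting section. *)
pose Phi (b : 'I_q) : 'M[int]_((size s).-1.+1) :=
  \matrix_(i, j) (#|[pred c | h b s`_j c == s`_i]|)%:Z.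
pose v : 'cV[int]_((size s).-1.+1) := \col_i (i == index 1 s :> nat)%:Z.
exists (size s).-1, Phi, v => alpha a0.
pose N (p : {mpoly F[k]}) := size (coef_exponents p alpha).
pose u n : 'rV[int]_((size s).-1.+1) := \row_j (N (s`_j * f ^+ n))%:Z.
have u_step (b : 'I_q) n : u (b + n * q)%N = u n *m Phi b.
  apply/rowP => j; rewrite !mxE.
  have sj: s`_j \in s by apply: mem_nth; rewrite -[leqRHS]s_size.
  rewrite exprD exprM mulrA /N (size_coef_exponents_msection _ q_gt0 a0).
  under eq_bigr => c _ do rewrite msection_mul_pow_card.
  rewrite (sum_count_seq (h := h b s`_j) (fun g => N (g * f ^+ n)) s_uniq).
    rewrite (big_nth 0) -[X in index_iota 0 X]s_size big_mkord.
    rewrite (big_morph Posz PoszD (erefl _)).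
    by apply: eq_bigr => i _; rewrite !mxE PoszM.
  by move=> c; apply: h_s.
have u_prod r (a : 'I_r -> 'I_q) :
    u (\sum_(i < r) a i * q ^ i)%N =
    u 0%N *m \prod_(i < r) Phi (a (rev_ord i)).
  (* The induction peels off the lowest digit, which is the rightmost factor; the remaining digits
     shift down by one place. *)
  elim: r a => [|r IHr] a; first by rewrite !big_ord0 mulmx1.
  rewrite big_ord_recl expn0 muln1 big_ord_recr /= -mulmxE mulmxA.
  have -> : rev_ord ord_max = ord0 :> 'I_r.+1 by apply/val_inj; rewrite /= subnn.
  have -> : (\sum_(i < r) a (lift ord0 i) * q ^ lift ord0 i =
      (\sum_(i < r) a (lift ord0 i) * q ^ i) * q)%N.
    by rewrite big_distrl; apply: eq_bigr => i _; rewrite /= expnSr mulnA.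
  rewrite u_step (IHr (fun i => a (lift ord0 i))); congr (_ *m _ *m _).
  apply: eq_bigr => i _; congr (Phi (a _)); apply/val_inj => /=.
  by rewrite /bump /= add1n subSS -subSn.
exists (u 0%N) => n r a _ n_eq; rewrite -u_prod -n_eq mxE.
(* Only the entry of the row vector at [g = 1] survives the product with [v], and it counts for
   [1 * f ^+ n]. *)
have lt_1s: (index 1%R s < (size s).-1.+1)%N by rewrite s_size index_mem.
rewrite (bigD1 (Ordinal lt_1s)) //= big1 ?addr0; last first.
  by move=> i; rewrite -val_eqE /= !mxE => /negbTE->; rewrite mulr0.
by rewrite !mxE /= eqxx mulr1 nth_index // mul1r.
Qed.
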